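(* Let $\mathcal S=\{S_1,\dots,S_m\}$ and $\tilde{\mathcal S}=\{\tilde S_1,\dots,\tilde S_m\}$ be two systems of injective contractions of complete metric spaces whose attractors $K$ and $\tilde K$ are self-similar dendrites with finite self-similar boundaries. If the systems $\mathcal S$ and $\tilde{\mathcal S}$ have isomorphic $P$-sprouts $\Gamma$ and $\tilde\Gamma$, then their attractors $K$ and $\tilde K$ are isomorphic.
   Context: For a system $\mathcal S=\{S_1,\dots,S_m\}$ of injective contractions of a complete metric space, the attractor $K$ is the unique nonempty compact set with $K=\bigcup_{i=1}^m S_i(K)$. Write $I=\{1,\dots,m\}$, $I^*=\bigcup_{n\ge1}I^n$, $S_{\mathbf j}=S_{j_1}\circ\dots\circ S_{j_n}$ for $\mathbf j=j_1\dots j_n\in I^*$, and $K_i=S_i(K)$. The critical set is $\mathcal C=\bigcup_{i\ne j}K_i\cap K_j$ ($i,j\in I$), and the self-similar boundary $\partial K$ is the set of all $x\in K$ such that $S_{\mathbf i}(x)\in\mathcal C$ for some $\mathbf i\in I^*$. $K$ is a self-similar dendrite if it is a dendrite, i.e. a locally connected continuum containing no simple closed curve. $P$-sprout of $\mathcal S$ (with $P=\partial K$ finite): the edge-labeled bipartite intersection graph $\Gamma(\mathcal S)=(W,B,E,\varphi)$ with parts $W=\{K_1,\dots,K_m\}$ and $B=\mathcal C\cup\partial K$, in which $e=(K_i,b)$ is an edge exactly when $b\in K_i$; the label $\varphi(e)\in P$ of $e=(K_i,b)$ is the unique point $q\in\partial K$ with $S_i(q)=b$. Two sprouts $(W,B,E,\varphi:E\to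 P)$ and $(\tilde W,\tilde B,\tilde E,\tilde\varphi:\tilde E\to\tilde P)$, where $P\subset B$ and $\tilde P\subset\tilde B$, are isomorphic if there is a bijection $x\mapsto x'$ between the respective sets ($B\to\tilde B$, $W\to\tilde W$, $E\to\tilde E$, $P\to\tilde P$) that preserves the incidence relation and satisfies $(\varphi(e))'=\tilde\varphi(e')$ for every $e\in E$. The attractors $K$ and $\tilde K$ of $\mathcal S$ and $\tilde{\mathcal S}$ are isomorphic if there is a homeomorphism $f:K\to\tilde K$ such that $f(S_i(x))=\tilde S_i(f(x))$ for every $x\in K$ and every $i\in I$.
   Formalization: A sprout isomorphism may permute the pieces, so the literal conclusion can fail; here the attractors are isomorphic after renumbering by the permutation s with K_i' = K̃_{s(i)}, i.e. f(S_i(x)) = S̃_{s(i)}(f(x)). *)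

(* Defs.v *)
From HB Require Import structures.
From mathcomp Require Import all_boot all_order all_algebra.
From mathcomp Require Import all_classical all_reals all_analysis.
Import Order.TTheory GRing.Theory Num.Theory.
Import numFieldNormedType.Exports.

Set Implicit Arguments.
Unset Strict Implicit.
Unset Printing Implicit Defensive.

Local Open Scope classical_set_scope.
Local Open Scope ring_scope.

#[short(type="completeMetricType")]
HB.structure Definition CompleteMetric (R : numDomainType) :=
  {T of Complete T & Metric R T}.

Definition homeomorphism_on (T U : topologicalType) (A : set T) (B : set U)
    (f : T -> U) : Prop :=
  [/\ set_bij A B f,
      {within A, continuous f} &
      exists g : U -> T,
        {within B, continuous g} /\ (forall x, A x -> g (f x) = x)].

Definition unit_circle (R : realType) : set (R * R) :=
  [set p | p.1 ^+ 2 + p.2 ^+ 2 = 1].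

Definition simple_closed_curve (R : realType) (T : topologicalType)
    (A : set T) : Prop :=
  exists f : R * R -> T, homeomorphism_on (@unit_circle R) A f.

(* Local connectedness of the subspace A: relatively open connected subsets
   of A form a base of its topology. *)
Definition locally_connected (T : topologicalType) (A : set T) : Prop :=
  forall (x : T) (U : set T), A x -> open U -> U x ->
    exists V : set T,
      [/\ open V, V x, V `&` A `<=` U & connected (V `&` A)].

Definition continuum (T : topologicalType) (A : set T) : Prop :=
  [/\ A !=set0, compact A & connected A].

Definition dendrite (R : realType) (T : topologicalType) (A : set T) : Prop :=
  [/\ continuum A, locally_connected A &
      ~ exists2 C : set T, C `<=` A & simple_closed_curve R C].

Section System.
Context {R : realType} {X : metricType R} {m : nat}.
Implicit Types (S : 'I_m -> X -> X) (K : set X).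

Definition contractive (f : X -> X) : Prop :=
  exists q : R, [/\ 0 <= q, q < 1 &
    forall x y, mdist (f x) (f y) <= q * mdist x y].

Definition injective_contractions S : Prop :=
  forall i, injective (S i) /\ contractive (S i).

Definition is_attractor S K : Prop :=
  [/\ K !=set0, compact K & K = \bigcup_i (S i @` K)].

Definition piece S K (i : 'I_m) : set X := S i @` K.

Definition word_map S (w : seq 'I_m) : X -> X :=
  foldr (fun i f => S i \o f) id w.

Definition critical_set S K : set X :=
  [set x | exists i j : 'I_m, i != j /\ (piece S K i `&` piece S K j) x].

Definition self_similar_boundary S K : set X :=
  [set x | K x /\
    exists2 w : seq 'I_m, w != [::] & critical_set S K (word_map S w x)].

End System.

(* Edge-labelled bipartite graph with parts [white] (W) and [black] (B); an
   edge is the pair of its two ends, and the labels of edges lie in the set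
   [labels] (P) of black vertices. *)
Record sprout (V X : Type) := Sprout {
  white : set V;
  black : set X;
  labels : set X;
  edges : set (V * X);
  label : V * X -> X
}.

(* The label of (K_i, b) is the point q of the boundary with S_i(q) = b; the
   default b in [xget] is never reached on an edge.  The pieces K_i are
   pairwise distinct (so that K_i determines i) except when K is a single
   point, and then q is that point for every i. *)
Definition sprout_of (R : realType) (X : metricType R) (m : nat)
    (S : 'I_m -> X -> X) (K : set X) : sprout (set X) X :=
  {| white := range (piece S K);
     black := critical_set S K `|` self_similar_boundary S K;
     labels := self_similar_boundary S K;
     edges := [set e | [/\ range (piece S K) e.1,
                 (critical_set S K `|` self_similar_boundary S K) e.2 &
                 e.1 e.2]];
     label := fun e => xget e.2
       [set q | self_similar_boundary S K q /\
                exists2 i, piece S K i = e.1 & S i q = e.2] |}.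

(* As P is a subset of B, the map on labels is the map [gB] on black
   vertices. *)
Definition sprout_isomorphism (V X V' X' : Type)
    (G : sprout V X) (G' : sprout V' X')
    (gW : V -> V') (gB : X -> X') (gE : V * X -> V' * X') : Prop :=
  [/\ [/\ set_bij (white G) (white G') gW,
          set_bij (black G) (black G') gB,
          set_bij (edges G) (edges G') gE &
          set_bij (labels G) (labels G') gB],
      forall e, edges G e -> (gE e).1 = gW e.1 /\ (gE e).2 = gB e.2 &
      forall e, edges G e -> gB (label G e) = label G' (gE e)].

Definition attractors_isomorphic (R : realType) (X Y : metricType R) (m : nat)
    (S : 'I_m -> X -> X) (K : set X) (S' : 'I_m -> Y -> Y) (K' : set Y) : Prop :=
  exists f : X -> Y, homeomorphism_on K K' f /\
    forall (x : X) (i : 'I_m), K x -> f (S i x) = S' i (f x).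

(* Main.v *)
(** A point of K is determined by its addresses (infinite words in I), so it
    suffices that two words are addresses of the same point of K exactly when
    the renumbered words are addresses of the same point of K'.  If two words
    first differ at position n and name the same point, then injectivity of
    S_{j_1...j_n} shows that the two tails name points p, q of the boundary
    with S_i(p) = S_j(q) critical.  The labels of the edges at that critical
    point are p and q, so the sprout isomorphism gives
    S'_{s i}(gB p) = S'_{s j}(gB q).  Since S_i(q) = p on the boundary also
    transfers to S'_{s i}(gB q) = gB p, every address of p is carried to an
    address of gB p.  Words of length n, whose pieces shrink uniformly, replace
    infinite words throughout.

    The pieces are pairwise distinct unless K is a point, since
    K_i = K_j with i != j makes the connected set K equal to its finite
    boundary. *)
Require Import Defs.
From mathcomp Require Import all_boot all_order all_algebra perm.
From mathcomp Require Import all_classical all_reals all_analysis.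

Set Implicit Arguments.
Unset Strict Implicit.
Unset Printing Implicit Defensive.

Import Order.TTheory GRing.Theory Num.Theory.
Import numFieldNormedType.Exports.

Local Open Scope classical_set_scope.
Local Open Scope ring_scope.

(** * Finite connected sets and bounds on compact sets *)

(** Finite sets are closed in a T1 space, so the point [x] is both closed in [A] and, its complement
    in [A] being finite, open in [A]. *)
Lemma connected_finite_set1 (T : topologicalType) (A : set T) (x : T) :
  accessible_space T -> finite_set A -> connected A -> A x -> A = [set x].
Proof.
move=> T1 fA cA Ax; apply/esym/cA; first by exists x.
- exists (~` (A `\ x)).
    apply: closed_openC; apply: (iffLR (@accessible_finite_set_closed T)) => //.
    exact: finite_setD.
  apply/seteqP; split=> [y ->|y [Ay]] /=; first by split=> // -[].
  by move=> nAy; apply: contrapT => yx; apply: nAy.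
- exists [set x]; first exact: accessible_closed_set1.
  by apply/seteqP; split=> [y ->|y []].
Qed.

Lemma compact_mdist_bounded (R : realType) (X : metricType R) (K : set X) :
  compact K -> exists D : R, forall x y, K x -> K y -> mdist x y < D.
Proof.
move=> /compact_near_coveringP cK.
case: (pselect (K !=set0)) => [[a Ka]|K0]; last first.
  by exists 0 => x y Kx; case: K0; exists x.
(* The balls about [a] of radius [e] tending to infinity cover [K]; compactness makes every radius
   strictly beyond some [e] work, hence [e + 1] below. *)
have [|e [_ he]] := cK _ (pinfty_nbhs R) (fun e x => mdist a x < e) _.
  move=> x Kx; exists (ball x 1, [set e | mdist a x + 1 < e]).
    split; first exact: nbhsx_ballx.
    by exists (mdist a x + 1); rewrite num_real.
  move=> [y e] /= [+ xe]; rewrite ballEmdist /= => xy.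
  apply: le_lt_trans xe; apply: le_trans (metric_triangle a x y) _.
  by rewrite lerD2l ltW.
exists ((e + 1) + (e + 1)) => x y Kx Ky.
have h z : K z -> mdist a z < e + 1 by apply: he; rewrite ltrDl.
apply: (le_lt_trans (metric_triangle x a y)).
by rewrite ltrD // ?h// metric_sym h.
Qed.

(** * Words and the shrinking of their pieces *)

Section words.
Context {R : realType} {X : metricType R} {m : nat}.
Variables (S : 'I_m -> X -> X) (K : set X).
Hypotheses (hS : injective_contractions S) (hK : is_attractor S K).

Lemma word_map_cat w v : word_map S (w ++ v) = word_map S w \o word_map S v.
Proof. by elim: w => //= i w ->. Qed.

Lemma attractor_stable i x : K x -> K (S i x).
Proof. by case: hK => _ _ {2}-> Kx; exists i => //; exists x. Qed.

Lemma word_map_attractor w x : K x -> K (word_map S w x).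
Proof. by move=> Kx; elim: w => //= i w; exact: attractor_stable. Qed.

Lemma attractor_preimage x : K x -> exists i, exists2 y, K y & S i y = x.
Proof. by case: hK => _ _ {1}-> [i _ [y Ky <-]]; exists i, y. Qed.

Lemma contraction_word_le : exists q : R, [/\ 0 <= q, q < 1 &
  forall w x y,
    mdist (word_map S w x) (word_map S w y) <= q ^+ size w * mdist x y].
Proof.
have /choice[q hq] i : exists q : R, [/\ 0 <= q, q < 1 &
    forall x y, mdist (S i x) (S i y) <= q * mdist x y] by case: (hS i).
(* A common ratio for the finitely many maps; the base value 0 is itself nonnegative and below 1. *)
pose Q := \big[Num.max/0]_i q i.
have Q0 : 0 <= Q by rewrite /Q; apply: bigmax_ge_id.
exists Q; split => //.
  by apply/bigmax_ltP; split => // i _; case: (hq i).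
elim => [|i w IH] x y /=; first by rewrite expr0 mul1r.
have [q0 q1 /(_ (word_map S w x) (word_map S w y)) hi] := hq i.
apply: (le_trans hi); rewrite exprS -mulrA.
apply: ler_pM => //; [exact: mdist_ge0|exact: le_bigmax].
Qed.

Lemma contractive_continuous (f : X -> X) : contractive f -> continuous f.
Proof.
case=> q [q0 q1 hf] x; apply/metricType_numDomainType.cvgrPdist_lt => e e0.
apply/metricType_numDomainType.nbhs_mdistP; exists e => // y /= xy.
apply: (le_lt_trans (hf x y)); apply: le_lt_trans xy.
by rewrite ler_piMl// ?mdist_ge0// ltW.
Qed.

Lemma word_map_continuous w : continuous (word_map S w).
Proof.
elim: w => [|i w IH] x; first exact: cvg_id.
apply: continuous_comp; first exact: IH.
by apply: contractive_continuous; case: (hS i).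
Qed.

Lemma closed_word_piece w : closed (word_map S w @` K).
Proof.
apply: compact_closed; first exact: metric_hausdorff.
apply: continuous_compact; last by case: hK.
by apply: continuous_subspaceT; exact: word_map_continuous.
Qed.

Lemma word_diam_lt (e : R) : 0 < e -> exists n, forall w x y,
  size w = n -> K x -> K y -> mdist (word_map S w x) (word_map S w y) < e.
Proof.
move=> e0; have [q [q0 q1 hq]] := contraction_word_le.
have [_ /compact_mdist_bounded[D hD] _] := hK.
have : (fun n => q ^+ n * D) @ \oo --> (0 : R).
  rewrite -[X in _ --> X](mul0r D); apply: cvgMr_tmp.
  by apply: cvg_expr; rewrite ger0_norm.
move=> /cvgrPdist_lt/(_ _ e0)[n _ /(_ n (leqnn n))] /=.
rewrite sub0r normrN => hn.
exists n => w x y wn Kx Ky; apply: (le_lt_trans (hq w x y)); rewrite wn.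
apply: le_lt_trans hn; apply: le_trans (ler_norm _).
by rewrite ler_wpM2l ?exprn_ge0// ltW ?hD.
Qed.

End words.

(** * Common addresses in two systems and the resulting homeomorphism *)

(* Only a relation between the points of K and L that matter (the boundaries)
   is asked for; nothing is assumed about rel on the rest of K. *)
Definition junction_simulation (X Y : Type) (m : nat)
    (S : 'I_m -> X -> X) (K : set X) (T : 'I_m -> Y -> Y) (L : set Y)
    (rel : X -> Y -> Prop) : Prop :=
  [/\ forall x y, rel x y -> L y,
      forall i x y, K x -> rel (S i x) y -> exists2 y', T i y' = y & rel x y' &
      forall i j x x', i != j -> K x -> K x' -> S i x = S j x' ->
        exists y y', [/\ rel x y, rel x' y' & T i y = T j y']].

(** The words for different [n] are chosen independently: later arguments compare only words of
    equal length. *)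
Definition same_address (R : realType) (X Y : metricType R) (m : nat)
    (S : 'I_m -> X -> X) (K : set X) (T : 'I_m -> Y -> Y) (L : set Y)
    (x : X) (y : Y) : Prop :=
  forall n, exists w, [/\ size w = n,
    (word_map S w @` K) x & (word_map T w @` L) y].

Lemma same_address_sym (R : realType) (X Y : metricType R) (m : nat)
    (S : 'I_m -> X -> X) (K : set X) (T : 'I_m -> Y -> Y) (L : set Y) x y :
  same_address S K T L x y -> same_address T L S K y x.
Proof. by move=> xy n; have [w [? ? ?]] := xy n; exists w. Qed.

Section transfer.
Context {R : realType} {X Y : metricType R} {m : nat}.
Variables (S : 'I_m -> X -> X) (K : set X) (T : 'I_m -> Y -> Y) (L : set Y).
Hypotheses (hS : injective_contractions S) (hK : is_attractor S K).
Hypotheses (hT : injective_contractions T) (hL : is_attractor T L).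

Lemma same_address_inl x y : same_address S K T L x y -> K x.
Proof.
by move=> /(_ 0%N)[w [_ [z Kz <-] _]]; exact: word_map_attractor.
Qed.

Lemma same_address_map i x y : same_address S K T L x y ->
  same_address S K T L (S i x) (T i y).
Proof.
move=> xy [|n].
  exists [::]; split => //=.
    exists (S i x) => //; apply: (attractor_stable hK).
    exact: same_address_inl xy.
  exists (T i y) => //; apply: (attractor_stable hL).
  by have [w [_ _ [z Lz <-]]] := xy 0%N; exact: word_map_attractor.
have [w [<- [x' Kx' <-] [y' Ly' <-]]] := xy n.
by exists (i :: w); split; [|exists x'|exists y'].
Qed.

(** An itinerary of [x] is read in the other system from a base point [b]. Each closed piece along
    it contains a tail of the sequence [u], hence also its cluster point. *)
Lemma same_address_exists x : K x -> exists y, same_address S K T L x y.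
Proof.
move=> Kx; have [[b Lb] cL _] := hL.
(* [d] gives the first letter and the tail of a point of [K]. Off [K] the letter is arbitrary, and
   one exists because [K] has a point. *)
have /choice[d hd] z : exists iz : 'I_m * X, K z -> K iz.2 /\ S iz.1 iz.2 = z.
  case: (pselect (K z)) => [/(attractor_preimage hK)[i [z' ? ?]]|nKz].
    by exists (i, z').
  have [i _] := attractor_preimage hK Kx.
  by exists (i, z).
pose tl n := iter n (fun z => (d z).2) x.
have Ktl n : K (tl n) by elim: n => //= n /hd[].
pose w n := mkseq (fun k => (d (tl k)).1) n.
have wS n : w n.+1 = w n ++ [:: (d (tl n)).1].
  by rewrite /w /mkseq -addn1 iotaD map_cat.
have wx n : word_map S (w n) (tl n) = x.
  elim: n => [//|n IH]; rewrite wS word_map_cat -[RHS]IH /comp.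
  by congr word_map; case: (hd _ (Ktl n)).
pose u n := word_map T (w n) b.
have uL n k : (word_map T (w n) @` L) (u (n + k)%N).
  rewrite /u /w /mkseq iotaD map_cat word_map_cat /=.
  by eexists; [|reflexivity]; exact: word_map_attractor.
have [|y [_ uy]] := cL (u @ \oo) _.
  exists 0%N => // n _ /=; have [z Lz <-] := uL 0%N n; exact: Lz.
exists y => n; exists (w n); split; first by rewrite size_mkseq.
- by exists (tl n).
- apply: (closed_word_piece hT hL); rewrite clusterE in uy; apply: uy.
  exists n => // k /= nk; rewrite -(subnKC nk); exact: uL.
Qed.

Variable rel : X -> Y -> Prop.
Hypothesis sim : junction_simulation S K T L rel.

Lemma simulation_word w x y : K x -> rel (word_map S w x) y ->
  exists2 y', word_map T w y' = y & rel x y'.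
Proof.
case: sim => _ step _ Kx; elim: w y => [|i w IH] y /=; first by exists y.
move=> /step[|y1 <- /IH[y' <- xy']]; first exact: word_map_attractor.
by exists y'.
Qed.

(* The common prefix of the two words is cancelled by injectivity; the rest
   of the two words then departs from a point of the critical set. *)
Lemma word_pieces_meet w v x x' : size w = size v -> K x -> K x' ->
  word_map S w x = word_map S v x' ->
  exists y y', [/\ L y, L y' & word_map T w y = word_map T v y'].
Proof.
move=> + Kx Kx'; elim: w v => [|i w IH] [|j v] //=.
  by have [[b Lb] _ _] := hL => _ _; exists b, b.
case=> wv; have [<-|ij] := eqVneq i j.
  case: (hS i) => injS _ /injS/(IH _ wv)[y [y' [? ? e]]].
  by exists y, y'; rewrite e.
case: sim => relL _ jct eS.
have [|| y [y' [xy xy' eT]]] := jct _ _ _ _ ij _ _ eS.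
- exact: word_map_attractor.
- exact: word_map_attractor.
have [z zy xz] := simulation_word Kx xy.
have [z' zy' xz'] := simulation_word Kx' xy'.
by exists z, z'; split; [exact: relL xz|exact: relL xz'|rewrite zy zy'].
Qed.

(** Words whose pieces share [x] have pieces of [L] that meet; for long words each has points less
    than [e / 2] apart. Uniqueness and continuity both follow from this. *)
Lemma word_pieces_close (e : R) : 0 < e -> exists n, forall w v x y y',
  size w = n -> size v = n ->
  (word_map S w @` K) x -> (word_map S v @` K) x ->
  (word_map T w @` L) y -> (word_map T v @` L) y' -> mdist y y' < e.
Proof.
move=> e0; have e20 : 0 < e / 2 by rewrite divr_gt0.
have [n hn] := word_diam_lt hT hL e20; exists n.
move=> w v x ? ? wn vn [a Ka ax] [b Kb bx] [y Ly <-] [y' Ly' <-].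
have [||||z [z' [Lz Lz' zz']]] := @word_pieces_meet w v a b.
- by rewrite wn.
- by [].
- by [].
- by rewrite ax bx.
apply: (le_lt_trans (metric_triangle _ (word_map T w z) _)).
by rewrite (splitr e) ltrD //; [exact: hn|rewrite zz'; exact: hn].
Qed.

Lemma same_address_uniq x y y' :
  same_address S K T L x y -> same_address S K T L x y' -> y = y'.
Proof.
move=> xy xy'; apply/mdist_positivity/eqP; rewrite eq_le mdist_ge0 andbT.
apply/ler_addgt0Pl => e /word_pieces_close[n hn]; rewrite addr0 ltW//.
have [w [wn wx wy]] := xy n; have [v [vn vx vy]] := xy' n.
exact: (hn w v x).
Qed.

Lemma same_address_continuous (f : X -> Y) :
  (forall x, K x -> same_address S K T L x (f x)) -> {within K, continuous f}.
Proof.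
move=> hf; apply/subspace_continuousP => x Kx.
apply/metricType_numDomainType.cvgrPdist_lt => e /word_pieces_close[n hn].
(* There are finitely many words of length [n], and the pieces missing [x] are closed, so a
   neighbourhood of [x] avoids them all. A word for a nearby [z] thus also names a piece containing
   [x]. *)
have : \forall z \near x, forall w : n.-tuple 'I_m,
    (word_map S w @` K) z -> (word_map S w @` K) x.
  apply: filter_forall => w.
  case: (pselect ((word_map S w @` K) x)) => [wx|nwx].
    by apply: nearW => z _.
  have : open (~` (word_map S w @` K)).
    by apply: closed_openC; exact: (closed_word_piece hS hK).
  rewrite openE => /(_ x nwx); apply: filterS => z nwz /nwz [].
rewrite near_withinE; apply: filterS => z hz Kz.
have [w [wn wx wy]] := hf x Kx n; have [v [vn vz vy]] := hf z Kz n.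
apply: (hn w v x) => //.
by move/eqP: vn => vn; exact: (hz (Tuple vn)).
Qed.

End transfer.

(** [sim] makes [f] single-valued and [sim'] does so for [g]; having a common address is symmetric,
    so they are mutually inverse. Prefixing a letter preserves common addresses, which gives the
    conjugacy. *)
Theorem junction_simulation_isomorphic (R : realType) (X Y : metricType R)
    (m : nat) (S : 'I_m -> X -> X) (K : set X) (T : 'I_m -> Y -> Y) (L : set Y)
    (rel : X -> Y -> Prop) :
  injective_contractions S -> is_attractor S K ->
  injective_contractions T -> is_attractor T L ->
  junction_simulation S K T L rel ->
  junction_simulation T L S K (fun y x => rel x y) ->
  attractors_isomorphic S K T L.
Proof.
move=> hS hK hT hL sim sim'.
have [[a Ka] _ _] := hK; have [[b Lb] _ _] := hL.
pose f x := xget b (same_address S K T L x).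
pose g y := xget a (same_address T L S K y).
have fP x : K x -> same_address S K T L x (f x).
  by move=> /(same_address_exists hK hT hL)/(xgetPex b).
have gP y : L y -> same_address T L S K y (g y).
  by move=> /(same_address_exists hL hS hK)/(xgetPex a).
have fL x : K x -> L (f x).
  by move=> /fP/same_address_sym; exact: same_address_inl.
have gK y : L y -> K (g y).
  by move=> /gP/same_address_sym; exact: same_address_inl.
have fK x : K x -> g (f x) = x.
  move=> Kx; apply: (same_address_uniq hT hL hS hK sim' (gP _ (fL _ Kx))).
  exact/same_address_sym/fP.
have gfK y : L y -> f (g y) = y.
  move=> Ly; apply: (same_address_uniq hS hK hT hL sim (fP _ (gK _ Ly))).
  exact/same_address_sym/gP.
exists f; split; first split.
- split.
  + by move=> x /= Kx; exact: fL.
  + by move=> x x' /[!inE] Kx Kx' e; rewrite -(fK x)// e fK.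
  + by move=> y Ly; exists (g y); [exact: gK|exact: gfK].
- exact: (same_address_continuous hS hK hT hL sim fP).
- exists g; split=> //; exact: (same_address_continuous hT hL hS hK sim' gP).
- move=> x i Kx.
  apply: (same_address_uniq hS hK hT hL sim (fP _ (attractor_stable hK i Kx))).
  exact/same_address_map/fP.
Qed.

(** * Boundary points, edge labels and one-point attractors *)

Section boundary.
Context {R : realType} {X : metricType R} {m : nat}.
Variables (S : 'I_m -> X -> X) (K : set X).
Hypotheses (hS : injective_contractions S) (hK : is_attractor S K).

(** The witnessing word is [i] alone when [S i q] is critical, and otherwise the word witnessing
    [S i q] in the boundary, followed by [i]. *)
Lemma black_preimage_boundary i q : K q ->
  black (sprout_of S K) (S i q) -> self_similar_boundary S K q.
Proof.
move=> Kq [cq|[_ [w w0 cq]]]; split => //; first by exists [:: i].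
by exists (rcons w i); [case: (w)|rewrite -cats1 word_map_cat].
Qed.

Lemma sprout_edge i q : K q -> black (sprout_of S K) (S i q) ->
  edges (sprout_of S K) (piece S K i, S i q).
Proof. by move=> Kq bq; split => //=; [exists i|exists q]. Qed.

(** The white end recovers [i] by injectivity of [piece], and the black end then recovers [q] by
    injectivity of [S i]. *)
Lemma sprout_label i q : injective (piece S K) -> K q ->
  black (sprout_of S K) (S i q) ->
  label (sprout_of S K) (piece S K i, S i q) = q.
Proof.
move=> injP Kq bq /=; set A := [set _ | _].
have [_ [k /injP -> ekq]] : A (xget (S i q) A).
  apply: (xgetPex (S i q)); exists q.
  by split; [exact: black_preimage_boundary bq|exists i].
by case: (hS i) => /(_ _ _ ekq).
Qed.

(* If two pieces coincide then every point of K is sent into the critical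
   set, so that K is equal to its finite boundary. *)
Lemma piece_injective_or_singleton : connected K ->
  finite_set (self_similar_boundary S K) ->
  injective (piece S K) \/ exists x, K = [set x].
Proof.
move=> cK fK; case: (pselect (injective (piece S K))) => [|ninj]; [by left|right].
have [[x Kx] _ _] := hK; exists x.
apply: connected_finite_set1 => //.
  exact/hausdorff_accessible/metric_hausdorff.
apply: sub_finite_set fK => y Ky; split => //.
have [i [j [ij eij]]] : exists i j, i != j /\ piece S K i = piece S K j.
  apply: contrapT => h; apply: ninj => i j eij.
  apply: contrapT => /eqP ij; apply: h; by exists i, j.
exists [:: i] => //; exists i, j; split => //=.
by split; [|rewrite -eij]; exists y.
Qed.

Lemma singleton_attractor_fixed i x : K = [set x] -> S i x = x.
Proof. by have := attractor_stable hK i (x := x) => + eK; rewrite eK => ->. Qed.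

Lemma singleton_attractor_piece i x : K = [set x] -> piece S K i = [set x].
Proof.
by move=> eK; rewrite /piece eK image_set1 (singleton_attractor_fixed i eK).
Qed.

(** With one white vertex every [S i] maps [K] onto [K], so [K] is the piece of arbitrarily long
    words [nseq n i] and has diameter 0. This carries the one-point case across [gW]. *)
Lemma white_singleton_attractor A :
  white (sprout_of S K) `<=` [set A] -> exists x, K = [set x].
Proof.
move=> WA; have [[x Kx] _ eK] := hK; exists x.
have sK i : S i @` K = K.
  apply/seteqP; split => [_ [y Ky <-]|y Ky]; first exact: (attractor_stable hK).
  have [j Kj] := attractor_preimage hK Ky.
  case: Kj => z Kz zy; have SA k : S k @` K = A.
    by apply: (WA (piece S K k)); exists k.
  by rewrite SA -(SA j); exists z.
have [i _] := attractor_preimage hK Kx.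
have wK n : word_map S (nseq n i) @` K = K.
  elim: n => [|n IH]; first by rewrite image_id.
  by rewrite -[in RHS](sK i) -[in RHS]IH -image_comp.
apply/seteqP; split => [y Ky|_ ->] //=; apply/esym/mdist_positivity/eqP.
rewrite eq_le mdist_ge0 andbT; apply/ler_addgt0Pl => e.
move=> /(word_diam_lt hS hK)[n hn]; rewrite addr0 ltW//.
move: Kx Ky; rewrite -(wK n) => -[x' Kx' <-] [y' Ky' <-].
by apply: hn; rewrite ?size_nseq.
Qed.

End boundary.

Lemma singleton_attractors_isomorphic (R : realType) (X Y : metricType R)
    (m : nat) (S : 'I_m -> X -> X) (S' : 'I_m -> Y -> Y) (x : X) (y : Y) :
  is_attractor S [set x] -> is_attractor S' [set y] ->
  attractors_isomorphic S [set x] S' [set y].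
Proof.
move=> hK hK'; exists (cst y).
split => [|z i _]; last by rewrite /cst (singleton_attractor_fixed hK').
split.
- split; [by move=> ? _| |by move=> _ ->; exists x].
  by move=> a b /[!inE] -> ->.
- by apply: continuous_subspaceT => z; exact: cvg_cst.
- exists (cst x); split => [|_ ->] //.
  by apply: continuous_subspaceT => z; exact: cvg_cst.
Qed.

(** * From an isomorphism of sprouts to simulations in both directions *)

Section sprouts.
Context {R : realType} {X Y : metricType R} {m : nat}.
Variables (S : 'I_m -> X -> X) (S' : 'I_m -> Y -> Y) (K : set X) (K' : set Y).
Hypotheses (hS : injective_contractions S) (hS' : injective_contractions S').
Hypotheses (hK : is_attractor S K) (hK' : is_attractor S' K').
Hypotheses (injP : injective (piece S K)) (injP' : injective (piece S' K')).
Variables (gW : set X -> set Y) (gB : X -> Y) (gE : set X * X -> set Y * Y).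
Hypothesis hG : sprout_isomorphism (sprout_of S K) (sprout_of S' K') gW gB gE.

Let rel x y := self_similar_boundary S K x /\ y = gB x.

Lemma sprout_isomorphism_perm : exists s : {perm 'I_m},
  forall i, gW (piece S K i) = piece S' K' (s i).
Proof.
case: hG => -[[WW' injW _] _ _ _] _ _.
have /choice[s hs] i : exists j, gW (piece S K i) = piece S' K' j.
  by have [|j _ <-] := WW' (piece S K i); [exists i|exists j].
have injs : injective s.
  move=> i j sij; apply/injP/injW; rewrite ?inE; [by exists i|by exists j|].
  by rewrite !hs sij.
by exists (perm injs) => i; rewrite permE.
Qed.

Variable s : {perm 'I_m}.
Hypothesis gWs : forall i, gW (piece S K i) = piece S' K' (s i).

(** The edge from [piece S K i] to [S i q] has label [q]. Its image joins [piece S' K' (s i)] to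
    [gB (S i q)] and has label [gB q], which [S' (s i)] therefore sends to that black end. *)
Lemma sprout_isomorphism_piece i q : K q -> black (sprout_of S K) (S i q) ->
  K' (gB q) /\ gB (S i q) = S' (s i) (gB q).
Proof.
case: hG => -[_ _ [EE' _ _] _] gEe gEl Kq bq.
have e1 := sprout_edge Kq bq.
have := EE' _ e1; have := gEl _ e1; have := gEe _ e1.
rewrite (sprout_label hS injP Kq bq); case: (gE _) => /= A b [-> ->].
rewrite gWs => -> [_ b' [q' Kq' eq']]; rewrite -eq' in b' *.
by rewrite [xget _ _](sprout_label hS' injP' Kq' b').
Qed.

(** Surjectivity on edges lifts the edge at [gB b]; incidence identifies the lift as the edge from
    [piece S K i] to [b], so [b] is some [S i q]. The forward law and injectivity of [S' (s i)] give
    [gB q = q']. *)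
Lemma sprout_isomorphism_piece_inv i b q' : black (sprout_of S K) b ->
  K' q' -> gB b = S' (s i) q' ->
  exists q, [/\ K q, S i q = b, self_similar_boundary S K q & gB q = q'].
Proof.
case: hG => -[[_ injW _] [BB' injB _] [_ _ surjE] _] gEe _ bb Kq' eb.
have b' : black (sprout_of S' K') (S' (s i) q') by rewrite -eb; exact: BB'.
have [e /= Ee eE] := surjE _ (sprout_edge Kq' b').
have [gE1 gE2] := gEe _ Ee; case: Ee => -[k _ ek] be.
rewrite -ek => -[q Kq eq]; rewrite eE /= in gE1 gE2.
have ik : i = k by apply/(@perm_inj _ s)/injP'; rewrite gE1 -ek gWs.
have eb2 : e.2 = b by apply: injB; rewrite ?inE // -gE2.
have Siq : S i q = b by rewrite ik eq.
have bq : black (sprout_of S K) (S i q) by rewrite Siq.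
have [_ gBq] := sprout_isomorphism_piece Kq bq.
exists q; split => //; first exact: black_preimage_boundary bq.
by case: (hS' (s i)) => + _; apply; rewrite -gBq Siq.
Qed.

Lemma sprout_isomorphism_simulation :
  junction_simulation S K (fun i => S' (s i)) K' rel.
Proof.
have dB' : set_bij (self_similar_boundary S K) (self_similar_boundary S' K') gB.
  by case: hG => -[].
have step i q : K q -> black (sprout_of S K) (S i q) ->
    rel q (gB q) /\ gB (S i q) = S' (s i) (gB q).
  move=> Kq bq; have [_ ->] := sprout_isomorphism_piece Kq bq.
  by split=> //; split=> //; exact: black_preimage_boundary bq.
split.
- by case: dB' => BB _ _ x y [/BB[? _] ->].
- move=> i x y Kx [dx ->]; have [|] := @step i x Kx; first by right.
  by exists (gB x).
- move=> i j x x' ij Kx Kx' e.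
  have c : critical_set S K (S i x).
    by exists i, j; split => //; split; [exists x|exists x'].
  have [|rx ex] := @step i x Kx; first by left.
  have [|rx' ex'] := @step j x' Kx'; first by left; rewrite -e.
  by exists (gB x), (gB x'); rewrite -ex -ex' e.
Qed.

Lemma sprout_isomorphism_simulation_inv :
  junction_simulation (fun i => S' (s i)) K' S K (fun y x => rel x y).
Proof.
split.
- by move=> y x [[]].
- move=> i y x Ky [dx eB].
  have [|q [Kq <- dq <-]] := @sprout_isomorphism_piece_inv i x y _ Ky (esym eB).
    by right.
  by exists q.
- move=> i j y y' ij Ky Ky' e.
  have c' : critical_set S' K' (S' (s i) y).
    exists (s i), (s j); split; first by rewrite (inj_eq perm_inj).
    by split; [exists y|exists y'].
  (* Both [y] and [y'] are pulled back along edges at the same black vertex [b], so the two lifts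
     have the common image [b]. *)
  have [b bb eb] : exists2 b, black (sprout_of S K) b & gB b = S' (s i) y.
    by case: hG => -[_ [_ _ surjB] _ _] _ _; apply: surjB; left.
  have [x [Kx xb dx <-]] := sprout_isomorphism_piece_inv bb Ky eb.
  rewrite e in eb.
  have [x' [Kx' xb' dx' <-]] := sprout_isomorphism_piece_inv bb Ky' eb.
  by exists x, x'; rewrite xb xb'.
Qed.

End sprouts.

(* The isomorphism of sprouts may permute the pieces, and so the systems are
   matched along the renumbering s that it induces: K_i' = K'_{s i}. *)
Theorem theorem4p8 (R : realType) (X Y : completeMetricType R) (m : nat)
    (S : 'I_m -> X -> X) (S' : 'I_m -> Y -> Y) (K : set X) (K' : set Y)
    (hS : injective_contractions S) (hS' : injective_contractions S')
    (hK : is_attractor S K) (hK' : is_attractor S' K')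
    (dK : dendrite R K) (dK' : dendrite R K')
    (fK : finite_set (self_similar_boundary S K))
    (fK' : finite_set (self_similar_boundary S' K'))
    (gW : set X -> set Y) (gB : X -> Y) (gE : set X * X -> set Y * Y)
    (hG : sprout_isomorphism (sprout_of S K) (sprout_of S' K') gW gB gE) :
  exists s : {perm 'I_m},
    (forall i : 'I_m, gW (piece S K i) = piece S' K' (s i)) /\
    attractors_isomorphic S K (fun i => S' (s i)) K'.
Proof.
have [[_ _ cK] _ _] := dK; have [[_ _ cK'] _ _] := dK'.
have [WW injW surjW] :
  set_bij (white (sprout_of S K)) (white (sprout_of S' K')) gW.
  by case: hG => -[].
have singl x y : K = [set x] -> K' = [set y] -> exists s : {perm 'I_m},
    (forall i : 'I_m, gW (piece S K i) = piece S' K' (s i)) /\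
    attractors_isomorphic S K (fun i => S' (s i)) K'.
  (* All pieces of a one-point attractor coincide, so the identity renumbering agrees with [gW]. *)
  move=> ex ey; exists 1%g; split => [i|].
    have [|j _ <-] := WW (piece S K i); first by exists i.
    by rewrite !(singleton_attractor_piece hK' _ ey).
  rewrite ex ey; apply: singleton_attractors_isomorphic; first by rewrite -ex.
  by under eq_fun do rewrite perm1; rewrite -ey.
have [injP|[x ex]] := piece_injective_or_singleton hK cK fK; last first.
  (* [K] has a single white vertex and [gW] is onto, so [K'] is a point too; the symmetric case
     below uses injectivity of [gW]. *)
  have [|y ey] := white_singleton_attractor hS' hK' (A := gW [set x]).
    move=> _ /surjW[_ [i _ <-] <-] /=.
    by rewrite (singleton_attractor_piece hK _ ex).
  exact: singl ex ey.
have [injP'|[y ey]] := piece_injective_or_singleton hK' cK' fK'; last first.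
  have [[a Ka] _ _] := hK; have [k _] := attractor_preimage hK Ka.
  have gW1 A : white (sprout_of S K) A -> gW A = [set y].
    by move=> /WW[i _ <-]; exact: singleton_attractor_piece ey.
  have [|x ex] := white_singleton_attractor hS hK (A := piece S K k).
    have Wk : white (sprout_of S K) (piece S K k) by exists k.
    by move=> A WA; apply: injW; rewrite ?inE // !gW1.
  exact: singl ex ey.
have [s hs] := sprout_isomorphism_perm injP hG; exists s; split => //.
have hT : injective_contractions (fun i => S' (s i)) by move=> i; exact: hS'.
have hKT : is_attractor (fun i => S' (s i)) K'.
  have [? ? eK'] := hK'; split => //; rewrite {1}eK'.
  apply/seteqP; split => y [i _ iy]; last by exists (s i).
  by exists ((s^-1)%g i) => //; rewrite permKV.
exact: junction_simulation_isomorphic hS hK hT hKT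
  (sprout_isomorphism_simulation hS hS' injP injP' hG hs)
  (sprout_isomorphism_simulation_inv hS hS' injP injP' hG hs).
Qed.
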